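(* Let $\hat h:\mathbb R^n\to\mathbb R\cup\{\infty\}$ be a Legendre kernel, let $\varphi:\mathbb R^n\to\mathbb R\cup\{\infty\}$ be proper and lsc, and let $\gamma\in(0,\gamma_\varphi^{\hat h})$ be fixed. Suppose further that $\hat h$ is locally Lipschitz differentiable and locally strongly convex on $\operatorname{int}\operatorname{dom}\hat h$ (as is the case when $\hat h\in\mathcal C^2$ with $\nabla^2\hat h\succ0$ on $\operatorname{int}\operatorname{dom}\hat h$) and that $\operatorname{range}\operatorname{prox}_{\gamma\varphi}^{\hat h}\subseteq\operatorname{int}\operatorname{dom}\hat h$. Then for every compact set $\mathcal U\subset\operatorname{int}\operatorname{dom}\hat h$ there exist $\bar\gamma>0$ and a convex compact set $\mathcal V$ with $\mathcal U\subseteq\mathcal V\subset\operatorname{int}\operatorname{dom}\hat h$ such that for all $\tilde\gamma\in(0,\bar\gamma)$, setting $$\tilde f:=-\tfrac1\gamma\hat h+\tfrac1{2\tilde\gamma}\|\cdot\|^2,\qquad \tilde g:=\varphi+\tfrac1\gamma\hat h-\tfrac1{2\tilde\gamma}\|\cdot\|^2+\delta_{\mathcal V},$$ it holds for all $x\in\mathcal U$ that $$\varphi^{\hat h/\gamma}(x)=\inf_{w\in\mathbb R^n}\Big\{\tilde f(x)+\langle\nabla\tilde f(x),w-x\rangle+\tilde g(w)+\tfrac1{2\tilde\gamma}\|w-x\|^2\Big\}$$ and $$\operatorname{prox}_{\gamma\varphi}^{\hat h}(x)=\operatorname{prox}_{\tilde\gamma\tilde g}\big(x-\tilde\gamma\nabla\tilde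 f(x)\big).$$ Moreover, $\tilde g$ is proper, lsc, and prox-bounded in the Euclidean sense with threshold $\gamma_{\tilde g}=\infty$, and $\tilde f$ is $L_{\tilde f}$-Lipschitz differentiable on $\mathcal V$ for some $L_{\tilde f}$ with $\tilde\gamma<1/L_{\tilde f}$.
   Context: A Legendre kernel is a proper, lsc, convex function $\hat h:\mathbb R^n\to\mathbb R\cup\{\infty\}$ with $\operatorname{int}\operatorname{dom}\hat h\ne\emptyset$, $\hat h\in\mathcal C^1(\operatorname{int}\operatorname{dom}\hat h)$, that is strictly convex, essentially smooth ($\|\nabla \hat h(x_k)\|\to\infty$ for every sequence in $\operatorname{int}\operatorname{dom}\hat h$ converging to a boundary point of $\operatorname{dom}\hat h$), and $1$-coercive ($\lim_{\|x\|\to\infty}\hat h(x)/\|x\|=\infty$). A property holds locally if every point has a convex neighborhood on which it holds. Bregman distance: $\mathrm D_{\hat h}(x,y)=\hat h(x)-\hat h(y)-\langle\nabla \hat h(y),x-y\rangle$ if $y\in\operatorname{int}\operatorname{dom}\hat h$, and $\infty$ otherwise. Bregman proximal map (on $\operatorname{int}\operatorname{dom}\hat h$) and Bregman-Moreau envelope: $\operatorname{prox}_{\gamma\varphi}^{\hat h}(x)=\operatorname*{argmin}_{z}\{\varphi(z)+\frac1\gamma \mathrm D_{\hat h}(z,x)\}$ and $\varphi^{\hat h/\gamma}(x)=\inf_z\{\varphi(z)+\frac1\gamma \mathrm D_{\hat h}(z,x)\}$. Without superscript, $\operatorname{prox}_{\tilde\gamma\tilde g}$ is the Euclidean one: $\operatorname{prox}_{\tilde\gamma\tilde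 g}(s)=\operatorname*{argmin}_w\{\tilde g(w)+\frac1{2\tilde\gamma}\|w-s\|^2\}$. Prox-boundedness threshold: $\gamma_\varphi^{\hat h}=\sup\{\gamma>0:\exists x\in\mathbb R^n,\ \varphi^{\hat h/\gamma}(x)>-\infty\}$; $\gamma_{\tilde g}$ is the threshold for $\frac12\|\cdot\|^2$ as kernel. $\delta_{\mathcal V}$ is the indicator function ($0$ on $\mathcal V$, $\infty$ elsewhere).
   Formalization: The threshold of φ takes x in int dom ĥ, not in ℝⁿ (else it is ∞ when int dom ĥ≠ℝⁿ and the claim fails: ĥ=x ln x−x, φ=−x², γ=1); argmin of a function ≡∞ is all of ℝⁿ, which excludes dom φ∩dom ĥ=∅; the parenthetical C² remark is not included. *)

(* Defs.v *)
From HB Require Import structures.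
From mathcomp Require Import all_boot all_order all_algebra.
From mathcomp Require Import all_classical all_reals all_analysis.
Import Order.TTheory GRing.Theory Num.Theory numFieldNormedType.Exports.

Set Implicit Arguments.
Unset Strict Implicit.
Unset Printing Implicit Defensive.

Local Open Scope classical_set_scope.
Local Open Scope ring_scope.

(* R^n is 'rV[R]_n.  The library norm `|x| on row vectors is the sup norm; it
   induces the usual topology (nbhs, interior, closure, compact, differentiable
   are taken from the library), but every quantitative statement below uses the
   Euclidean norm enorm.
   Functions into R u {oo} are functions into \bar R that never take the value
   -oo (see eproper); -h / gamma is allowed to take the value -oo. *)

Section Euclidean.
Context {R : realType} {n : nat}.
Implicit Types (x y : 'rV[R]_n) (F : 'rV[R]_n -> \bar R).

Definition dot x y : R := \sum_(i < n) x 0 i * y 0 i.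

Definition enorm x : R := Num.sqrt (dot x x).

Definition edom F : set 'rV[R]_n := [set x | (F x < +oo)%E].

Definition idom F : set 'rV[R]_n := interior (edom F).

(* fine sends both infinities to 0, so egrad F x is only meaningful at points
   near which F is finite; ediff includes this requirement. *)
Definition egrad F x : 'rV[R]_n :=
  \row_(i < n) 'D_(delta_mx 0 i) (fine \o F) x.

Definition ediff F x : Prop :=
  (\forall y \near x, F y \is a fin_num) /\ differentiable (fine \o F : _ -> R) x.

Definition eproper F : Prop :=
  (forall x, (-oo < F x)%E) /\ (exists x, (F x < +oo)%E).

Definition convex_efun F : Prop :=
  forall x y (t : R), 0 < t -> t < 1 ->
    (F (t *: x + (1 - t) *: y)%R <= t%:E * F x + (1 - t)%:E * F y)%E.

Definition strictly_convex_efun F : Prop :=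
  forall x y (t : R), edom F x -> edom F y -> x <> y -> 0 < t -> t < 1 ->
    (F (t *: x + (1 - t) *: y)%R < t%:E * F x + (1 - t)%:E * F y)%E.

Definition essentially_smooth F : Prop :=
  forall (u : nat -> 'rV[R]_n) x,
    (forall k, idom F (u k)) ->
    (closure (edom F) `\` interior (edom F)) x ->
    u @ \oo --> x ->
    (fun k => enorm (egrad F (u k))) @ \oo --> +oo.

Definition one_coercive F : Prop :=
  forall A : R, exists B : R, forall x, B < enorm x ->
    (A%:E < F x * ((enorm x)^-1)%:E)%E.

Record legendre_kernel F : Prop := LegendreKernel {
  legendre_proper : eproper F ;
  legendre_lsc : lower_semicontinuous F ;
  legendre_convex : convex_efun F ;
  legendre_idom : idom F !=set0 ;
  legendre_C1 : forall x, idom F x -> ediff F x /\ {for x, continuous (egrad F)} ;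
  legendre_strictly_convex : strictly_convex_efun F ;
  legendre_essentially_smooth : essentially_smooth F ;
  legendre_coercive : one_coercive F
}.

Definition locally_on (D : set 'rV[R]_n) (P : set 'rV[R]_n -> Prop) : Prop :=
  forall x, D x -> exists N : set 'rV[R]_n,
    [/\ nbhs x N, convex_set N, N `<=` D & P N].

Definition lipschitz_differentiable_on F (N : set 'rV[R]_n) (L : R) : Prop :=
  (forall x, N x -> ediff F x) /\
  (forall x y, N x -> N y -> enorm (egrad F x - egrad F y) <= L * enorm (x - y)).

(* Only used for N included in the domain of F, where fine loses nothing. *)
Definition strongly_convex_on F (N : set 'rV[R]_n) : Prop :=
  exists2 sigma : R, 0 < sigma &
    @convex_function R 'rV[R]_n N
      (fun x => fine (F x) - sigma / 2 * enorm x ^+ 2).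

Definition locally_lipschitz_differentiable F (D : set 'rV[R]_n) : Prop :=
  locally_on D (fun N => exists L : R, lipschitz_differentiable_on F N L).

Definition locally_strongly_convex F (D : set 'rV[R]_n) : Prop :=
  locally_on D (strongly_convex_on F).

Definition argmin F : set 'rV[R]_n := [set z | forall w, (F z <= F w)%E].

Definition indicator (V : set 'rV[R]_n) (x : 'rV[R]_n) : \bar R :=
  if x \in V then 0%E else +oo%E.

Definition eprox (g : 'rV[R]_n -> \bar R) (gamma : R) s : set 'rV[R]_n :=
  argmin (fun w => g w + ((2 * gamma)^-1 * enorm (w - s) ^+ 2)%:E)%E.

End Euclidean.

Section Bregman.
Context {R : realType} {n : nat}.
Implicit Types (h phi : 'rV[R]_n -> \bar R) (gamma : R) (x y : 'rV[R]_n).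

Definition bregman h x y : \bar R :=
  if y \in idom h then (h x - h y - (dot (egrad h y) (x - y))%:E)%E else +oo%E.

(* The Bregman proximal map is a set-valued map on idom h. *)
Definition bprox h phi gamma x : set 'rV[R]_n :=
  argmin (fun z => phi z + (gamma^-1)%:E * bregman h z x)%E.

Definition bprox_range h phi gamma : set 'rV[R]_n :=
  \bigcup_(x in idom h) bprox h phi gamma x.

Definition benv h phi gamma x : \bar R :=
  ereal_inf (range (fun z => phi z + (gamma^-1)%:E * bregman h z x)%E).

(* The envelope is considered on idom h.  Off idom h it is identically +oo by
   the convention on bregman, so letting x range over all of R^n would make the
   threshold +oo for every phi as soon as h does not have full domain. *)
Definition prox_threshold h phi : \bar R :=
  ereal_sup [set gamma%:E | gamma in
    [set gamma : R | 0 < gamma /\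
       exists2 x, idom h x & (-oo < benv h phi gamma x)%E]].

Definition half_sqnorm x : \bar R := (2^-1 * enorm x ^+ 2)%:E.

Definition ftilde h gamma (gammat : R) x : \bar R :=
  ((- gamma^-1)%:E * h x + ((2 * gammat)^-1 * enorm x ^+ 2)%:E)%E.

Definition gtilde h phi gamma (gammat : R) (V : set 'rV[R]_n) x : \bar R :=
  (phi x + (gamma^-1)%:E * h x - ((2 * gammat)^-1 * enorm x ^+ 2)%:E
   + indicator V x)%E.

End Bregman.

(* Main.v *)
Require Import Defs.
From HB Require Import structures.
From mathcomp Require Import all_boot all_order all_algebra.
From mathcomp Require Import all_classical all_reals all_analysis.
From mathcomp Require Import ring lra.
Import Order.TTheory GRing.Theory Num.Theory numFieldNormedType.Exports.

Set Implicit Arguments.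
Unset Strict Implicit.
Unset Printing Implicit Defensive.
Local Open Scope classical_set_scope.
Local Open Scope ring_scope.

(** Write Phi_x(z) = phi(z) + D_h(z,x)/gamma.  When x is in int dom h and w is
    in V, the quadratic model at x built from f~ and g~ has value Phi_x(w), all
    quadratic terms cancelling; off V it is +oo.  So it suffices to find a
    compact convex V inside int dom h containing U and prox(x) for all x in U:
    restricting Phi_x to V then changes neither its infimum nor its minimisers.
    Prox-boundedness and 1-coercivity make Phi_x coercive uniformly in x in U;
    lower semicontinuity gives minimisers, and together with compactness it
    keeps all of prox(U) at a positive distance from the complement of dom h.
    On V the gradient of h is Lipschitz and strongly monotone, so expanding
    |(x - y)/gamma~ - (grad h x - grad h y)/gamma|^2 gives a Lipschitz constant
    of grad f~ below 1/gamma~ as soon as gamma~ is small. *)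

(** * Euclidean inner product and norm over the sup-norm topology *)

Section EuclideanGeometry.
Context {R : realType} {n : nat}.
Implicit Types x y z : 'rV[R]_n.

Lemma dotC x y : dot x y = dot y x.
Proof. by apply: eq_bigr => i _; rewrite mulrC. Qed.

Lemma dotDl x y z : dot (x + y) z = dot x z + dot y z.
Proof. by rewrite -big_split; apply: eq_bigr => i _; rewrite !mxE mulrDl. Qed.

Lemma dotZl (a : R) x y : dot (a *: x) y = a * dot x y.
Proof. by rewrite mulr_sumr; apply: eq_bigr => i _; rewrite !mxE mulrA. Qed.

Lemma dotNl x y : dot (- x) y = - dot x y.
Proof. by rewrite -scaleN1r dotZl mulN1r. Qed.

Lemma dotDr x y z : dot z (x + y) = dot z x + dot z y.
Proof. by rewrite !(dotC z) dotDl. Qed.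

Lemma dotZr (a : R) x y : dot x (a *: y) = a * dot x y.
Proof. by rewrite !(dotC x) dotZl. Qed.

Lemma dotNr x y : dot x (- y) = - dot x y.
Proof. by rewrite !(dotC x) dotNl. Qed.

Definition dotE := (dotDl, dotDr, dotZl, dotZr, dotNl, dotNr).

Lemma dot_ge0 x : 0 <= dot x x.
Proof. by apply: sumr_ge0 => i _; rewrite -expr2 sqr_ge0. Qed.

Lemma dot_delta x i : dot x (delta_mx 0 i) = x 0 i.
Proof.
rewrite /dot (bigD1 i)//= mxE !eqxx mulr1 big1 ?addr0// => j /negPf ji.
by rewrite mxE ji andbF mulr0.
Qed.

Lemma enorm_sqr x : enorm x ^+ 2 = dot x x.
Proof. by rewrite sqr_sqrtr ?dot_ge0. Qed.

Lemma enorm_ge0 x : 0 <= enorm x.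
Proof. exact: sqrtr_ge0. Qed.

Lemma enormZ (a : R) x : enorm (a *: x) = `|a| * enorm x.
Proof.
by rewrite /enorm dotZl dotZr mulrA -expr2 sqrtrM ?sqr_ge0// sqrtr_sqr.
Qed.

Lemma enormN x : enorm (- x) = enorm x.
Proof. by rewrite /enorm dotNl dotNr opprK. Qed.

(** Links the sup norm, in which balls and compactness are stated, to the Euclidean norm of the
    estimates. *)
Lemma norm_le_enorm x : `|x| <= enorm x.
Proof.
have h i j : `|x i j| <= enorm x.
  rewrite -sqrtr_sqr ler_wsqrtr// (ord1 i) /dot (bigD1 j)//= expr2 lerDl.
  by apply: sumr_ge0 => k _; rewrite -expr2 sqr_ge0.
rewrite [`|x|]mx_normrE; apply: bigmax_le => [|[i j] _]; last exact: h.
exact: enorm_ge0.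
Qed.

Lemma cauchy_schwarz x y : `|dot x y| <= enorm x * enorm y.
Proof.
rewrite -sqrtr_sqr /enorm -sqrtrM ?dot_ge0// ler_wsqrtr//.
have := dot_ge0 y; rewrite le_eqVlt => /predU1P[y0|y0]; last first.
  (* Up to the factor y.y this is the component of [x] orthogonal to [y]; its squared norm is y.y
     times the gap in the squared inequality. *)
  have := dot_ge0 (dot y y *: x - dot x y *: y).
  rewrite !dotE (dotC y x) => h.
  rewrite -(ler_pM2l y0); nra.
have yi0 i : y 0 i = 0.
  have : `|y| <= 0 by rewrite (le_trans (norm_le_enorm y))// /enorm -y0 sqrtr0.
  by rewrite normr_le0 => /eqP ->; rewrite mxE.
by rewrite -y0 /dot big1 ?mulr0 ?expr0n// => i _; rewrite yi0 mulr0.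
Qed.

Lemma enormD x y : enorm (x + y) <= enorm x + enorm y.
Proof.
rewrite -(ler_pXn2r (ltn0Sn 1)) ?nnegrE ?addr_ge0 ?enorm_ge0//.
rewrite sqrrD !enorm_sqr !dotE (dotC y x).
have := ler_norm (dot x y); have := cauchy_schwarz x y; lra.
Qed.

Lemma continuous_dot (T : topologicalType) (f g : T -> 'rV[R]_n) (p : T) :
  {for p, continuous f} -> {for p, continuous g} ->
  {for p, continuous (fun q => dot (f q) (g q))}.
Proof.
move=> cf cg; rewrite /dot; apply: cvg_big => [|i _]; first exact: add_continuous.
apply: cvgM.
  by apply: (@cvg_comp _ _ _ f (fun v : 'rV[R]_n => v 0 i));
    [exact: cf|exact: coord_continuous].
by apply: (@cvg_comp _ _ _ g (fun v : 'rV[R]_n => v 0 i));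
  [exact: cg|exact: coord_continuous].
Qed.

Lemma continuous_enorm (T : topologicalType) (f : T -> 'rV[R]_n) (p : T) :
  {for p, continuous f} -> {for p, continuous (fun q => enorm (f q))}.
Proof.
move=> cf; apply: (continuous_comp (f := fun q => dot (f q) (f q)) (g := @Num.sqrt R)).
  exact: continuous_dot.
exact: sqrt_continuous.
Qed.

Lemma sqnormE : (fun y : 'rV[R]_n => enorm y ^+ 2 : R) =
  \sum_(i < n) (fun y : 'rV[R]_n => y 0 i : R) ^+ 2.
Proof.
apply/funext => y; rewrite enorm_sqr fct_sumE.
by apply: eq_bigr => i _; rewrite -expr2.
Qed.

Lemma is_derive_sqnorm (x v : 'rV[R]_n) :
  is_derive x v (fun y => enorm y ^+ 2 : R) (2 * dot x v).
Proof.
rewrite sqnormE.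
rewrite /dot mulr_sumr; apply: is_derive_sum => i.
have dc : is_derive x v (fun y : 'rV[R]_n => y 0 i : R) (v 0 i).
  have dx := differentiable_coord x 0 i.
  apply: DeriveDef; first exact: diff_derivable.
  rewrite /derive; apply/cvg_lim => //; apply: cvg_near_cst.
  near=> t; rewrite /= !mxE addrK /GRing.scale /= mulKf//.
  by near: t; exact: nbhs_dnbhs_neq.
apply: is_derive_eq; rewrite /GRing.scale /=; ring.
Unshelve. all: end_near. Qed.

Lemma differentiable_sqnorm (x : 'rV[R]_n) :
  differentiable (fun y : 'rV[R]_n => enorm y ^+ 2 : R) x.
Proof.
rewrite sqnormE.
apply: differentiable_sum => i; apply: differentiableX.
exact: differentiable_coord.
Qed.

End EuclideanGeometry.

(** Near [x] both functions have the same first-order expansion, so the differential of [f] also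
    serves for [g]. This is used for [ftilde], whose real expression is valid only locally. *)
Lemma near_eq_differentiable (R : numFieldType) (V W : normedModType R)
    (f g : V -> W) (x : V) :
  {near x, f =1 g} -> differentiable f x -> differentiable g x.
Proof.
move=> fg df.
have fg0 : \forall t \near (0 : V), g (t + x) = f (t + x).
  have := fg; rewrite (near_shift 0) /= subr0; apply: filterS => t /= ->.
  by [].
have [cdf ef] := (diff_locallyP _ _).1 df.
have eg : g \o shift x = cst (g x) + ('d f x : V -> W) +o_ 0 id.
  apply/eqaddoP => e e0; near=> t.
  have -> : (g \o shift x - (cst (g x) + 'd f x)) t =
      (f \o shift x - (cst (f x) + 'd f x)) t.
    rewrite /= -![(_ - _) t]/(_ t - _ t) -![(_ + _) t]/(_ t + _ t) /=
      (nbhs_singleton fg).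
    by congr (_ - _); near: t; rewrite near_simpl; exact: fg0.
  near: t; move: e e0; apply/eqaddoP.
  exact: ef.
have dg := diff_unique cdf eg.
by apply/diff_locallyP; rewrite dg.
Unshelve. all: end_near. Qed.

(** * Lower semicontinuity and attainment of minima *)

Lemma ereal_lt_fin_between (R : realFieldType) (x : R) (y : \bar R) :
  (x%:E < y)%E -> exists2 b : R, x < b & (b%:E < y)%E.
Proof.
case: y => [y| |//]; rewrite ?lte_fin => xy.
  by exists ((x + y) / 2); rewrite ?lte_fin; lra.
by exists (x + 1); [lra|rewrite ltry].
Qed.

Lemma lower_semicontinuous_sub (R : realType) (T : topologicalType)
    (F : T -> \bar R) (c : T -> R) (p : T) (a : R) :
  lower_semicontinuous F -> {for p, continuous c} ->
  (a%:E < F p - (c p)%:E)%E -> \forall q \near p, (a%:E < F q - (c q)%:E)%E.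
Proof.
move=> lF cc; rewrite lteBrDr// -EFinD => /ereal_lt_fin_between[b ab bF].
have [N nN NF] := lF _ _ bF.
have : \forall q \near p, c q < b - a.
  have /cvgrPdist_lt/(_ (b - a - c p)) := cc.
  rewrite subr_gt0 ltrBrDl => /(_ ab); apply: filterS => q.
  by rewrite ltr_norml => /andP[]; lra.
apply: filterS2 nN => q Nq cq.
rewrite lteBrDr// (le_lt_trans _ (NF _ Nq))// -EFinD lee_fin; lra.
Qed.

Lemma lower_semicontinuousD (R : realType) (T : topologicalType) (F G : T -> \bar R) :
  (forall x, -oo < F x)%E -> (forall x, -oo < G x)%E ->
  lower_semicontinuous F -> lower_semicontinuous G ->
  lower_semicontinuous (fun x => F x + G x)%E.
Proof.
move=> F0 G0 lF lG x a aFG.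
(* Split [a] as b + (a - b), each part strictly below its function; the choice of [b] depends on
   which values are infinite. *)
have [b [bF abG]] : exists b : R, (b%:E < F x)%E /\ ((a - b)%:E < G x)%E.
  case: (F x) (G x) (F0 x) (G0 x) aFG => [f| |//] [g| |//] _ _.
  - rewrite -EFinD lte_fin => h; exists (f - (f + g - a) / 2).
    by rewrite !lte_fin; split; lra.
  - by move=> _; exists (f - 1); rewrite lte_fin ltry; split => //; lra.
  - by move=> _; exists (a - g + 1); rewrite lte_fin ltry; split => //; lra.
  - by move=> _; exists 0; rewrite !ltry.
have [N nN NF] := lF _ _ bF; have [M nM MG] := lG _ _ abG.
exists (N `&` M); first exact: filterI.
move=> y [/NF yF /MG yG]; have := lteD yF yG.
by rewrite -EFinD addrC subrK.
Qed.

Lemma lower_semicontinuousZ (R : realType) (T : topologicalType) (F : T -> \bar R) (k : R) :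
  0 < k -> lower_semicontinuous F ->
  lower_semicontinuous (fun x => k%:E * F x)%E.
Proof.
move=> k0 lF x a; rewrite -lte_pdivrMl// -EFinM => /lF[N nN NF].
by exists N => // y /NF; rewrite EFinM lte_pdivrMl.
Qed.

(* If no point of K were a minimiser then, by compactness, some point of K
   would have a value below all values on K, its own included. *)
Lemma lsc_compact_min (R : realType) (T : topologicalType) (K : set T)
    (F : T -> \bar R) :
  compact K -> K !=set0 ->
  (forall x (a : R), (a%:E < F x)%E -> \forall y \near x, (a%:E < F y)%E) ->
  exists2 z, K z & forall w, K w -> (F z <= F w)%E.
Proof.
move=> cK K0 lF; apply: contrapT => nmin.
have lower z : K z -> exists2 w, K w & (F w < F z)%E.
  move=> Kz; apply: contrapT => nw; apply: nmin; exists z => // w Kw.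
  by rewrite leNgt; apply/negP => wz; apply: nw; exists w.
(* The filter of sublevel sets in [K] stands in for a minimising sequence: [F i] is eventually below
   any value that is not minimal. *)
pose S := filter_from K (fun w => [set i | K i /\ (F i <= F w)%E]).
have FS : ProperFilter S.
  apply: filter_from_proper; last by move=> w Kw; exists w; split=> /=.
  apply: filter_from_filter => // v w Kv Kw.
  case: (leP (F v) (F w)) => vw; [exists v|exists w] => // i [Ki iv]; split; split=> //.
    exact: le_trans vw.
  exact: le_trans (ltW vw).
have /compact_near_coveringP/(_ T S (fun i z => (F i < F z)%E) _) := cK.
have cov z : K z -> \forall z' \near z & i \near S, (F i < F z')%E.
  move=> Kz; have [w Kw wz] := lower _ Kz.
  have [a wa az] : exists2 a : R, (F w <= a%:E)%E & (a%:E < F z)%E.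
    case: (F w) wz => [r| |] wz; last first.
    - case: (F z) wz => [s| |//] _; last by exists 0; rewrite ?leNye ?ltry.
      by exists (s - 1); rewrite ?leNye// lte_fin; lra.
    - by move: wz; rewrite ltNge leey.
    - by exists r.
  exists ([set z' | (a%:E < F z')%E], [set i | K i /\ (F i <= F w)%E]).
    by split; [exact: lF|exists w].
  by move=> [z' i] /= [az' [_ iw]]; rewrite (le_lt_trans (le_trans iw wa)).
move=> /(_ cov) hS.
have hK : \forall i \near S, K i.
  by have [w Kw] := K0; exists w => // i /= [].
have [i [hi Ki]] := filter_ex (filterI hS hK).
by have := hi _ Ki; rewrite ltxx.
Qed.

(** * Lipschitz and monotonicity estimates for gradients *)

Section GradientEstimates.
Context {R : realType} {n : nat}.
Implicit Types (h : 'rV[R]_n -> \bar R) (x y v : 'rV[R]_n).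

Lemma convex_setP (V : set 'rV[R]_n) :
  convex_set V <-> forall x y (t : R), V x -> V y -> 0 < t -> t < 1 ->
    V (t *: x + (1 - t) *: y).
Proof.
split=> [cV x y t Vx Vy t0 t1|cV].
  have := cV x y (Itv01 (ltW t0) (ltW t1)) (mem_set Vx) (mem_set Vy).
  by move=> /set_mem.
apply/convex_setW => x y /set_mem Vx /set_mem Vy k k0 k1.
exact/mem_set/cV.
Qed.

Lemma derive_egrad h x v : differentiable (fine \o h : _ -> R) x ->
  'D_v (fine \o h) x = dot (egrad h x) v.
Proof.
move=> dh; rewrite deriveE// {1}(row_sum_delta v) linear_sum.
apply: eq_bigr => i _; rewrite linearZ mxE deriveE// mulrC //.
Qed.

(** Convexity of h - sigma/2 |.|^2 on the segment bounds the difference quotient of [h] at [x]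
    towards [y] by h(y) - h(x) - sigma/2 (1 - t) |y - x|^2; then t tends to 0 from the right. *)
Lemma strongly_convex_gradient_ineq h (N : set 'rV[R]_n) (sigma : R) x y :
  convex_set N ->
  @convex_function R 'rV[R]_n N
    (fun x => fine (h x) - sigma / 2 * enorm x ^+ 2) ->
  N x -> N y -> differentiable (fine \o h : _ -> R) x ->
  fine (h x) + dot (egrad h x) (y - x) + sigma / 2 * enorm (y - x) ^+ 2
    <= fine (h y).
Proof.
move=> cN ch Nx Ny dh; rewrite -derive_egrad//.
set d := y - x.
have cq : t^-1 *: ((fine \o h) (t *: d + x) - (fine \o h) x) @[t --> 0^'+] -->
    'D_d (fine \o h) x.
  exact/cvg_dnbhs_at_right/(diff_derivable dh).
have cr : fine (h y) - fine (h x) - sigma / 2 * (1 - t) * enorm d ^+ 2 @[t --> 0^'+]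
   --> fine (h y) - fine (h x) - sigma / 2 * (1 - 0) * enorm d ^+ 2.
  apply: cvg_at_right_filter; apply: cvgB; first exact: cvg_cst.
  apply: cvgMr_tmp; apply: cvgMl_tmp; apply: cvgB; first exact: cvg_cst.
  exact: cvg_id.
suff : 'D_d (fine \o h) x <=
    fine (h y) - fine (h x) - sigma / 2 * (1 - 0) * enorm d ^+ 2 by lra.
apply: (ler_cvg_to cq cr); near=> t.
have t0 : 0 < t by near: t; exact: nbhs_right_gt.
have t1 : t < 1 by near: t; exact: nbhs_right_lt.
rewrite /GRing.scale /= ler_pdivrMl//.
have cxy : fine (h (t *: d + x)) - sigma / 2 * enorm (t *: d + x) ^+ 2 <=
    t * (fine (h y) - sigma / 2 * enorm y ^+ 2)
    + (1 - t) * (fine (h x) - sigma / 2 * enorm x ^+ 2).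
  have -> : t *: d + x = t *: y + (1 - t) *: x.
    by rewrite /d scalerBr scalerBl scale1r [x - _]addrC addrA.
  exact: (ch (Itv01 (ltW t0) (ltW t1)) y x (mem_set Ny) (mem_set Nx)).
move: cxy.
have -> : enorm (t *: d + x) ^+ 2 =
    t * enorm y ^+ 2 + (1 - t) * enorm x ^+ 2 - t * (1 - t) * enorm d ^+ 2.
  rewrite !enorm_sqr /d !dotE (dotC x y); ring.
nra.
Unshelve. all: end_near. Qed.

Lemma strongly_convex_monotone h (N : set 'rV[R]_n) (sigma : R) x y :
  convex_set N ->
  @convex_function R 'rV[R]_n N
    (fun x => fine (h x) - sigma / 2 * enorm x ^+ 2) ->
  (forall x, N x -> differentiable (fine \o h : _ -> R) x) ->
  N x -> N y ->
  sigma * enorm (x - y) ^+ 2 <= dot (egrad h x - egrad h y) (x - y).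
Proof.
move=> cN ch dh Nx Ny.
have := strongly_convex_gradient_ineq cN ch Nx Ny (dh _ Nx).
have := strongly_convex_gradient_ineq cN ch Ny Nx (dh _ Ny).
rewrite -(opprB x y) enormN !dotE; lra.
Qed.

(* One constant k serves as Lipschitz and inverse monotonicity constant, so the
   property weakens as k grows and local constants can be pushed to +oo. *)
Definition bilipschitz_monotone_at (G : 'rV[R]_n -> 'rV[R]_n) (k : R) x y :=
  enorm (G x - G y) <= k * enorm (x - y) /\
  k^-1 * enorm (x - y) ^+ 2 <= dot (G x - G y) (x - y).

(* The estimates pass from pairs at distance < r to pairs at distance < 2 r
   by inserting the midpoint. *)
Lemma bilipschitz_monotone_of_small_scale (G : 'rV[R]_n -> 'rV[R]_n)
    (V : set 'rV[R]_n) (k d : R) :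
  convex_set V -> 0 < d ->
  (forall x y, V x -> V y -> `|x - y| < d -> bilipschitz_monotone_at G k x y) ->
  forall x y, V x -> V y -> bilipschitz_monotone_at G k x y.
Proof.
move=> /convex_setP cV d0 small.
have scale m x y : V x -> V y -> `|x - y| < d * 2 ^+ m ->
    bilipschitz_monotone_at G k x y.
  elim: m x y => [|m IH] x y Vx Vy xy.
    by apply: small => //; rewrite expr0 mulr1 in xy.
  set z := 2^-1 *: x + (1 - 2^-1) *: y.
  have Vz : V z by apply: cV => //; lra.
  have half1 : (1 - 2^-1 : R) = 2^-1 by lra.
  have xz : x - z = 2^-1 *: (x - y).
    by rewrite /z half1 scalerBr opprD addrA -{1}[x]scale1r -scalerBl half1.
  have zy : z - y = 2^-1 *: (x - y).
    rewrite /z half1 scalerBr -addrA; congr (_ + _).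
    by rewrite -{2}[y]scale1r -scalerBl -scaleNr; congr (_ *: _); lra.
  have hd : `|2^-1 *: (x - y)| < d * 2 ^+ m.
    rewrite normrZ ger0_norm// ltr_pdivrMl//; apply: lt_le_trans xy _.
    by rewrite exprS; lra.
  (* Both halves equal (x - y)/2, so each contributes half of each estimate and [k] is unchanged. *)
  have [l1 m1] := IH x z Vx Vz ltac:(by rewrite xz).
  have [l2 m2] := IH z y Vz Vy ltac:(by rewrite zy).
  move: l1 m1 l2 m2; rewrite xz zy !enormZ ger0_norm// !dotZr !exprMn => l1 m1 l2 m2.
  rewrite /bilipschitz_monotone_at.
  have -> : G x - G y = (G x - G z) + (G z - G y) by rewrite addrA subrK.
  split; last by rewrite dotDl; lra.
  by apply: le_trans (enormD _ _) _; lra.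
move=> x y Vx Vy; pose b := Num.bound (`|x - y| / d).
apply: (scale b) => //; rewrite mulrC -ltr_pdivrMr//.
exact: upper_nthrootP.
Qed.

(** Compactness is applied with k tending to +oo, [k] being both the constant of the estimates and
    the inverse of the distance below which they hold. The midpoint argument then removes the
    distance restriction. *)
Lemma bilipschitz_monotone_compact (G : 'rV[R]_n -> 'rV[R]_n)
    (V : set 'rV[R]_n) :
  compact V -> convex_set V ->
  (forall x, V x -> exists N k, [/\ nbhs x N, 0 < k &
    forall y z, N y -> N z -> bilipschitz_monotone_at G k y z]) ->
  exists2 k, 0 < k & forall x y, V x -> V y -> bilipschitz_monotone_at G k x y.
Proof.
move=> cV convV loc.
have /compact_near_coveringP/(_ R +oo (fun k x => forall y, `|x - y| < k^-1 ->
  bilipschitz_monotone_at G k x y) _) := cV.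
have cov x : V x -> \forall x' \near x & k \near +oo, forall y, `|x' - y| < k^-1 ->
    bilipschitz_monotone_at G k x' y.
  move=> /loc[N [l [/nbhs_ballP[e /= e0 eN] l0 Nl]]].
  (* Beyond this threshold [k] exceeds the local constant [l], and k^-1 < e/2 keeps [y] in the ball
     of radius [e]. *)
  exists (ball x (e / 2), [set k | Num.max l (e / 2)^-1 < k]).
    split; first by apply: nbhsx_ballx; rewrite divr_gt0.
    by exists (Num.max l (e / 2)^-1); split => //; exact: num_real.
  move=> [x' k] /= [xx']; rewrite gt_max => /andP[lk ek] y yx'.
  have e20 : 0 < e / 2 by rewrite divr_gt0.
  have k0 : 0 < k by rewrite (lt_trans l0).
  have ke : k^-1 < e / 2 by rewrite invf_plt// posrE.
  have [] := Nl x' y.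
  - by apply: eN; apply: le_ball xx'; lra.
  - apply: eN; rewrite (splitr e); apply: ball_triangle xx' _.
    by rewrite -ball_normE /=; lra.
  move=> hl hm; split.
    by apply: le_trans hl _; rewrite ler_wpM2r ?enorm_ge0// ltW.
  apply: le_trans hm; rewrite ler_wpM2r ?exprn_ge0 ?enorm_ge0//.
  by rewrite lef_pV2 ?posrE// ltW.
move=> /(_ cov) hV.
have /filter_ex[k [k0 Vk]] : \forall k \near +oo, 0 < k /\
    V `<=` [set x | forall y, `|x - y| < k^-1 -> bilipschitz_monotone_at G k x y].
  by near=> k; split; [near: k; exact: nbhs_pinfty_gt|near: k].
exists k => //; apply: (@bilipschitz_monotone_of_small_scale _ _ _ k^-1) => //.
  by rewrite invr_gt0.
by move=> x y Vx _; exact: Vk.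
Unshelve. all: end_near. Qed.

End GradientEstimates.

Lemma compact_upper_bound (R : realType) (T : topologicalType) (U : set T)
    (f : T -> R) :
  compact U -> (forall x, U x -> {for x, continuous f}) ->
  exists C, forall x, U x -> f x <= C.
Proof.
move=> /compact_near_coveringP cU cf.
have cov x : U x -> \forall x' \near x & k \near +oo, f x' <= k.
  move=> Ux; exists ([set x' | f x' < f x + 1], [set k | f x + 1 < k]).
    split; last by exists (f x + 1); split => //; exact: num_real.
    have /cvgrPdist_lt/(_ 1 ltr01) := cf _ Ux; apply: filterS => y /=.
    by rewrite ltr_norml => /andP[]; lra.
  by move=> [x' k] /= []; lra.
have [C CU] := filter_ex (cU R +oo (fun k x => f x <= k) _ cov).
by exists C.
Qed.

(** * The Bregman objective and its coercivity *)

Section BregmanObjective.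
Context {R : realType} {n : nat}.
Implicit Types (h phi : 'rV[R]_n -> \bar R) (x z w : 'rV[R]_n).

Lemma idom_fin h x : eproper h -> idom h x -> h x \is a fin_num.
Proof. by move=> [h0 _] /interior_subset hx; rewrite fin_numE -ltey -ltNye h0. Qed.

(** For [x] in [idom h], D_h(z, x) is h(z) minus this real number, which is affine in [z]. *)
Definition tangent h x z : R := fine (h x) + dot (egrad h x) (z - x).

Lemma tangent_continuous h x z : legendre_kernel h -> idom h x ->
  {for (x, z), continuous (fun p : 'rV[R]_n * 'rV[R]_n => tangent h p.1 p.2)}.
Proof.
move=> lh hx; have [[_ dh] ch] := legendre_C1 lh hx.
have c1 : {for (x, z), continuous (fst : 'rV[R]_n * 'rV[R]_n -> _)} by exact: cvg_fst.
have c2 : {for (x, z), continuous (snd : 'rV[R]_n * 'rV[R]_n -> _)} by exact: cvg_snd.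
have c3 : {for (x, z), continuous (fun p : 'rV[R]_n * 'rV[R]_n => fine (h p.1))}.
  apply: (continuous_comp (f := fst) (g := fine \o h)) => //.
  exact: differentiable_continuous.
have c4 : {for (x, z), continuous
    (fun p : 'rV[R]_n * 'rV[R]_n => dot (egrad h p.1) (p.2 - p.1))}.
  apply: continuous_dot; last exact: cvgB.
  exact: (continuous_comp (f := fst) (g := egrad h)).
exact: cvgD c3 c4.
Qed.

Lemma tangent_bound h x z (C : R) : 0 <= C ->
  `|fine (h x)| + enorm (egrad h x) + enorm x <= C ->
  `|tangent h x z| <= C + C * (enorm z + C).
Proof.
move=> C0 hC; rewrite /tangent; apply: le_trans (ler_normD _ _) _.
have := cauchy_schwarz (egrad h x) (z - x).
have := enormD z (- x); rewrite enormN.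
have := enorm_ge0 (egrad h x); have := enorm_ge0 x; have := enorm_ge0 z.
have := enorm_ge0 (z - x); have := normr_ge0 (fine (h x)) => *.
apply: lerD; first lra.
apply: le_trans; first by eassumption.
by apply: ler_pM; lra.
Qed.

(** The finite tangent term splits off even at infinite values, so the objective becomes an lsc
    function of [z] minus a continuous real function of (x, z). *)
Lemma bregman_objectiveE h phi (gamma : R) x z : 0 < gamma ->
  eproper h -> eproper phi -> idom h x ->
  (phi z + (gamma^-1)%:E * bregman h z x =
   phi z + (gamma^-1)%:E * h z - (gamma^-1 * tangent h x z)%:E)%E.
Proof.
move=> g0 ph pp hx; rewrite /bregman mem_set// /tangent.
have := idom_fin ph hx; have ig0 : 0 < gamma^-1 by rewrite invr_gt0.
case: (h x) => [a| |] // _ /=.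
have := ph.1 z; have := pp.1 z; case: (phi z) (h z) => [p| |] [b| |] //= _ _.
- by congr EFin; ring.
- by rewrite /= gt0_muley ?lte_fin.
- by rewrite /= gt0_muley ?lte_fin.
Qed.

Lemma bregman_objective_fin h phi (gamma : R) x z : 0 < gamma ->
  eproper h -> eproper phi -> idom h x -> edom phi z -> edom h z ->
  (phi z + (gamma^-1)%:E * bregman h z x)%E =
  (fine (phi z) + gamma^-1 * (fine (h z) - tangent h x z))%:E.
Proof.
move=> g0 ph pp hx pz hz; rewrite bregman_objectiveE//.
have := ph.1 z; have := pp.1 z; move: pz hz; rewrite /edom /=.
case: (phi z) (h z) => [p| |] [b| |] //= _ _ _ _.
by congr EFin; ring.
Qed.

Lemma bregman_objective_infty h phi (gamma : R) x z : 0 < gamma ->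
  eproper h -> eproper phi -> idom h x -> ~ (edom phi z /\ edom h z) ->
  (phi z + (gamma^-1)%:E * bregman h z x)%E = +oo%E.
Proof.
move=> g0 ph pp hx; rewrite bregman_objectiveE// /edom /=.
have ig0 : 0 < gamma^-1 by rewrite invr_gt0.
have := ph.1 z; have := pp.1 z.
case: (phi z) (h z) => [p| |] [b| |] //= _ _ nfin.
- by exfalso; apply: nfin; rewrite !ltry.
- by rewrite gt0_muley ?lte_fin.
- by rewrite gt0_muley ?lte_fin.
Qed.

(** With disjoint domains the objective would be +oo everywhere and every point would be a
    minimiser. The range condition would then make [h] finite everywhere, contradicting properness
    of [phi]. *)
Lemma objective_dom_nonempty h phi (gamma : R) : 0 < gamma ->
  legendre_kernel h -> eproper phi -> bprox_range h phi gamma `<=` idom h ->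
  exists w, edom phi w /\ edom h w.
Proof.
move=> g0 lh pp rg; apply: contrapT => none.
have [x hx] := legendre_idom lh; have ph := legendre_proper lh.
have all_dom w : edom h w.
  apply: interior_subset; apply: rg; exists x => // v.
  rewrite [X in (_ <= X)%E]bregman_objective_infty ?leey//.
  by move=> hv; apply: none; exists v.
by have [_ [w pw]] := pp; apply: none; exists w.
Qed.

(* Prox-boundedness at some gamma' > gamma bounds phi below by an affine
   function minus h / gamma', so the objective dominates
   (1 / gamma - 1 / gamma') h up to an affine term, which is coercive. *)
Lemma bregman_objective_coercive h phi (gamma : R) (U : set 'rV[R]_n) w :
  0 < gamma -> legendre_kernel h -> eproper phi ->
  (gamma%:E < prox_threshold h phi)%E ->
  compact U -> U `<=` idom h -> edom phi w -> edom h w ->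
  exists M : R, forall x z, U x -> M < `|z| ->
    (phi w + (gamma^-1)%:E * bregman h w x <
     phi z + (gamma^-1)%:E * bregman h z x)%E.
Proof.
move=> g0 lh pp thr cU Uh pw hw; have ph := legendre_proper lh.
have [_ [g' [g'0 [x0 hx0 benv0]] <-]] := ereal_sup_gt thr.
rewrite lte_fin => gg'.
have [b hb] : exists b : R, forall z,
    (b%:E <= phi z + (g'^-1)%:E * bregman h z x0)%E.
  have [b bB] : exists b : R, (b%:E <= benv h phi g' x0)%E.
    by case: (benv _ _ _ _) benv0 => [r| |//] _; [exists r|exists 0; rewrite leey].
  by exists b => z; apply: le_trans bB _; apply: ereal_inf_lbound; exists z.
have [C0 C0b] : exists C, forall x, (U `|` [set x0]) x ->
    `|fine (h x)| + enorm (egrad h x) + enorm x <= C.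
  apply: compact_upper_bound; first by apply: compactU => //; exact: compact_set1.
  move=> x Ux; have hx : idom h x by case: Ux => [/Uh//|->].
  have [[_ dh] ch] := legendre_C1 lh hx.
  have c1 : {for x, continuous (fun y => `|fine (h y)|)}.
    by have c0 := differentiable_continuous dh; exact: (cvg_norm c0).
  have c2 : {for x, continuous (fun y => enorm (egrad h y))}.
    exact: continuous_enorm.
  have c3 : {for x, continuous (fun y : 'rV[R]_n => enorm y)}.
    by apply: continuous_enorm; exact: cvg_id.
  exact: cvgD (cvgD c1 c2) c3.
have C00 : 0 <= C0.
  by apply: le_trans (C0b x0 _); [rewrite !addr_ge0 ?enorm_ge0|right].
have tb x z : (U `|` [set x0]) x -> `|tangent h x z| <= C0 + C0 * (enorm z + C0).
  by move=> Ux; apply: tangent_bound (C0b _ Ux).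
set ig := gamma^-1; set ig' := g'^-1.
have ig'0 : 0 < ig' by rewrite invr_gt0.
have igg' : ig' < ig by rewrite ltf_pV2 ?posrE.
(* Multiplied by ig - ig', this slope exceeds by one the combined growth rate (ig + ig') C0 of the
   two tangent terms. *)
have [B hB] := legendre_coercive lh (((ig + ig') * C0 + 1) / (ig - ig')).
(* [T] bounds the objective at [w] uniformly over [U]. Beyond the radius chosen next, the surplus
   slope one lifts the objective at [z] above [T]. *)
pose T := fine (phi w) + ig * (fine (h w) + (C0 + C0 * (enorm w + C0))).
exists (Num.max 0 (Num.max B (T - b + (ig + ig') * (C0 + C0 * C0)))) => x z Ux.
rewrite !gt_max => /and3P[z0 zB zT].
have hx := Uh _ Ux.
have zn := norm_le_enorm z.
rewrite bregman_objective_fin//.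
case: (pselect (edom phi z /\ edom h z)) => [[pz hz]|nfin]; last first.
  by rewrite (bregman_objective_infty _ _ _ _ nfin)// ltry.
rewrite bregman_objective_fin// lte_fin -/ig.
have := hb z; rewrite bregman_objective_fin// lee_fin -/ig'.
have := tb x z (or_introl Ux); have := tb x w (or_introl Ux).
have := tb x0 z (or_intror erefl).
rewrite !ler_norml => /andP[t1 _] /andP[t2 _] /andP[_ t3] low.
have ez0 : 0 < enorm z by apply: lt_le_trans zn.
have := hB z (lt_le_trans zB zn).
have -> : h z = (fine (h z))%:E by rewrite fineK// fin_numE -ltey -ltNye ph.1.
rewrite -EFinM lte_fin ltr_pdivlMr// mulrAC ltr_pdivrMr ?subr_gt0// => co.
have zT' := lt_le_trans zT zn.
have u1 : ig * tangent h x z <= ig * (C0 + C0 * (enorm z + C0)).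
  by rewrite ler_pM2l// (lt_trans ig'0).
have u2 : - (ig' * (C0 + C0 * (enorm z + C0))) <= ig' * tangent h x0 z.
  by rewrite -mulrN ler_pM2l//; lra.
have u3 : - (ig * (C0 + C0 * (enorm w + C0))) <= ig * tangent h x w.
  by rewrite -mulrN ler_pM2l ?(lt_trans ig'0)//; lra.
move: zT'; rewrite /T; lra.
Qed.

End BregmanObjective.

(** * Existence and localisation of Bregman proximal points *)

Section ProximalMap.
Context {R : realType} {n : nat}.
Implicit Types (h phi : 'rV[R]_n -> \bar R) (x z w u v : 'rV[R]_n).

Lemma objective_lower_semicontinuous h phi (gamma : R) : 0 < gamma ->
  eproper h -> eproper phi ->
  lower_semicontinuous h -> lower_semicontinuous phi ->
  lower_semicontinuous (fun z => phi z + (gamma^-1)%:E * h z)%E.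
Proof.
move=> g0 [h0 _] [p0 _] lh lp; have ig0 : 0 < gamma^-1 by rewrite invr_gt0.
apply: lower_semicontinuousD => // [x|]; last exact: lower_semicontinuousZ.
by have := h0 x; case: (h x) => [r| |]//= _; rewrite ?ltNyr// gt0_muley ?lte_fin.
Qed.

Lemma near_idom h x : idom h x -> \forall y \near x, idom h y.
Proof. by move=> hx; apply/nbhs_interior. Qed.

(** Joint in (x, z), so that compactness can act on pairs. The splitting of the tangent is available
    at nearby base points because [idom h] is open. *)
Lemma bregman_objective_lower_semicontinuous h phi (gamma : R) x z (a : R) : 0 < gamma ->
  legendre_kernel h -> eproper phi -> lower_semicontinuous phi ->
  idom h x -> (a%:E < phi z + (gamma^-1)%:E * bregman h z x)%E ->
  \forall p \near (x, z),
    (a%:E < phi p.2 + (gamma^-1)%:E * bregman h p.2 p.1)%E.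
Proof.
move=> g0 lh pp lp hx; have ph := legendre_proper lh.
rewrite bregman_objectiveE// => aF.
have lF := objective_lower_semicontinuous g0 ph pp (legendre_lsc lh) lp.
have lF2 : lower_semicontinuous (fun p : 'rV[R]_n * 'rV[R]_n =>
    phi p.2 + (gamma^-1)%:E * h p.2)%E.
  move=> p b /lF[N nN NF]; exists (setT `*` N); last by move=> q [_ /NF].
  by exists (setT, N) => //; split=> //; exact: filterT.
have tc : {for (x, z), continuous
    (fun p : 'rV[R]_n * 'rV[R]_n => gamma^-1 * tangent h p.1 p.2)}.
  have c0 := tangent_continuous (z := z) lh hx; exact: (cvgM (cvg_cst _) c0).
have := @lower_semicontinuous_sub _ _ _ _ (x, z) a lF2 tc aF.
have nx : \forall p \near (x, z), idom h p.1.
  exists (idom h, setT); last by move=> q [].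
  by split; [exact: near_idom|exact: filterT].
by apply: filterS2 nx => p hp; rewrite bregman_objectiveE.
Qed.

Lemma compact_closed_ball0 (M : R) :
  compact (closed_ball_ Num.norm (0 : 'rV[R]_n) M).
Proof.
apply: bounded_closed_compact; last exact: closed_closed_ball_.
exists M; split; first exact: num_real.
move=> y My v; rewrite /closed_ball_ /= sub0r normrN => vM.
exact: le_trans vM (ltW My).
Qed.

Lemma bprox_nonempty h phi (gamma : R) x : 0 < gamma ->
  legendre_kernel h -> eproper phi -> lower_semicontinuous phi ->
  (gamma%:E < prox_threshold h phi)%E ->
  bprox_range h phi gamma `<=` idom h ->
  idom h x -> bprox h phi gamma x !=set0.
Proof.
move=> g0 lh pp lp thr rg hx.
have [w [pw hw]] := objective_dom_nonempty g0 lh pp rg.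
have sx : [set x] `<=` idom h by move=> _ ->.
have [M hM] := bregman_objective_coercive g0 lh pp thr (@compact_set1 _ x) sx pw hw.
(* The ball contains [w], so its minimum is at most the value at [w], which lies below all values
   outside. *)
pose K : set 'rV[R]_n := closed_ball_ Num.norm 0 (Num.max M `|w|).
have Kw : K w by rewrite /K /closed_ball_ /= sub0r normrN le_max lexx orbT.
have cK : compact K by exact: compact_closed_ball0.
have [] := @lsc_compact_min R _ K
  (fun z => phi z + (gamma^-1)%:E * bregman h z x)%E cK.
- by exists w.
- move=> z a az; have [[A B] /= [nA nB] AB] :=
    bregman_objective_lower_semicontinuous g0 lh pp lp hx az.
  by apply: filterS nB => z' Bz'; apply: (AB (x, z')); split=> //; exact: nbhs_singleton.
move=> z Kz zmin; exists z => v.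
have [Mv|vM] := leP `|v| (Num.max M `|w|).
  by apply: zmin; rewrite /K /closed_ball_ /= sub0r normrN.
apply: le_trans (zmin _ Kw) _; apply/ltW/hM => //.
by move: vM; rewrite gt_max => /andP[].
Qed.

(** Moving the centre by less than r/2 and shifting by less than r/2 stays within the interior
    radius r; compactness makes the admissible shift uniform. *)
Lemma compact_thickening (A U : set 'rV[R]_n) :
  compact U -> U `<=` interior A ->
  exists2 e : R, 0 < e & forall x u, U x -> `|u| < e -> A (x + u).
Proof.
move=> /compact_near_coveringP cU UA.
pose S : set_system R := 0^'+.
have FS : ProperFilter S by exact: at_right_proper_filter.
have S0 : \forall e \near S, 0 < e by exact: nbhs_right_gt.
have cov x : U x -> \forall x' \near x & e \near S, forall u, `|u| < e -> A (x' + u).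
  move=> /UA/nbhs_ballP[r /= r0 rA].
  have r20 : 0 < r / 2 by rewrite divr_gt0.
  exists (ball x (r / 2), [set e | e < r / 2]).
    by split; [exact: nbhsx_ballx|exact: nbhs_right_lt].
  move=> [x' e] /= [xx' er] u ue; apply: rA.
  rewrite (splitr r); apply: ball_triangle xx' _.
  by rewrite -ball_normE /= opprD addrA subrr sub0r normrN (lt_trans ue).
have [e [e0 He]] := filter_ex (filterI S0
  (cU R S (fun e x => forall u, `|u| < e -> A (x + u)) _ cov)).
by exists e => // x u Ux; exact: He.
Qed.

(* A pair (x, z) with z in prox(x) persists in a ball of dom h because z is
   interior; a pair with z outside prox(x) is excluded nearby because
   Phi_x(w) < Phi_x(z) is an open condition.  Compactness makes this uniform. *)
Lemma bprox_thickening h phi (gamma : R) (U : set 'rV[R]_n) (M : R) :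
  0 < gamma ->
  legendre_kernel h -> eproper phi -> lower_semicontinuous phi ->
  bprox_range h phi gamma `<=` idom h ->
  compact U -> U `<=` idom h ->
  exists2 e : R, 0 < e & forall x z u, U x -> bprox h phi gamma x z ->
    `|z| <= M -> `|u| < e -> edom h (z + u).
Proof.
move=> g0 lh pp lp rg cU Uh; have ph := legendre_proper lh.
pose K : set 'rV[R]_n := closed_ball_ Num.norm 0 M.
have cK : compact K by exact: compact_closed_ball0.
have /compact_near_coveringP cUK := compact_setX cU cK.
pose S : set_system R := 0^'+.
have FS : ProperFilter S by exact: at_right_proper_filter.
have S0 : \forall e \near S, 0 < e by exact: nbhs_right_gt.
have cov p : (U `*` K) p -> \forall p' \near p & e \near S,
    bprox h phi gamma p'.1 p'.2 -> forall u, `|u| < e -> edom h (p'.2 + u).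
  case: p => x z [/= Ux Kz]; have hx := Uh _ Ux.
  have [xz|nxz] := pselect (bprox h phi gamma x z).
    have /nbhs_ballP[r /= r0 rA] : idom h z by apply: rg; exists x.
    have r20 : 0 < r / 2 by rewrite divr_gt0.
    exists (setT `*` ball z (r / 2), [set e | e < r / 2]).
      split; last exact: nbhs_right_lt.
      exists (setT, ball z (r / 2)) => //; split; first exact: filterT.
      exact: nbhsx_ballx.
    move=> [[x' z'] e] /= [[_ zz'] er] _ u ue; apply: rA.
    rewrite (splitr r); apply: ball_triangle zz' _.
    by rewrite -ball_normE /= opprD addrA subrr sub0r normrN (lt_trans ue).
  have [w wz] : exists w, (phi w + (gamma^-1)%:E * bregman h w x <
      phi z + (gamma^-1)%:E * bregman h z x)%E.
    apply: contrapT => nw; apply: nxz => w.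
    by rewrite leNgt; apply/negP => wz; apply: nw; exists w.
  (* The value at [w] is below another value, hence not +oo; so it is a continuous real function of
     the base point. *)
  have [pw hw] : edom phi w /\ edom h w.
    apply: contrapT => nfin; move: wz.
    by rewrite (bregman_objective_infty _ _ _ _ nfin)// ltNge leey.
  move: wz; rewrite bregman_objective_fin// => /ereal_lt_fin_between[a wa az].
  have nz := bregman_objective_lower_semicontinuous g0 lh pp lp hx az.
  have nw : \forall p \near (x, z), idom h p.1 /\
      fine (phi w) + gamma^-1 * (fine (h w) - tangent h p.1 w) < a.
    have cw : {for x, continuous (fun y =>
        fine (phi w) + gamma^-1 * (fine (h w) - tangent h y w))}.
      have c0 : {for x, continuous (fun y => tangent h y w)}.
        apply: (continuous_comp (f := fun y => (y, w))
          (g := fun p : 'rV[R]_n * 'rV[R]_n => tangent h p.1 p.2)).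
          move=> B [[C D] /= [nC nD] CD]; apply: filterS nC => y Cy.
          by apply: (CD (y, w)); split=> //; exact: nbhs_singleton.
        exact: tangent_continuous.
      exact: (cvgD (cvg_cst _) (cvgM (cvg_cst _) (cvgB (cvg_cst _) c0))).
    exists ([set y | idom h y /\
      fine (phi w) + gamma^-1 * (fine (h w) - tangent h y w) < a], setT).
      split; last exact: filterT.
      apply: filterI; first exact: near_idom.
      have /cvgrPdist_lt/(_ (a - (fine (phi w) +
        gamma^-1 * (fine (h w) - tangent h x w)))) := cw.
      rewrite subr_gt0 => /(_ wa); apply: filterS => y /=.
      by rewrite ltr_norml => /andP[]; lra.
    by move=> [y v] /= [].
  (* Near (x, z) the level [a] still separates the two values, so no pair there is proximal and the
     claim holds vacuously for every [e]. *)
  exists ([set p | bprox h phi gamma p.1 p.2 -> False], setT); last first.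
    by move=> [p e] /= [np _] /np.
  split; last exact: filterT.
  apply: filterS2 nz nw => -[x' z'] /= az' [hx' wa'] /(_ w).
  rewrite /= (bregman_objective_fin (z := w))//.
  by rewrite leNgt => /negP; apply; rewrite (lt_trans _ az')// lte_fin.
have [e [e0 He]] := filter_ex (filterI S0
  (cUK R S (fun e p => bprox h phi gamma p.1 p.2 ->
    forall u, `|u| < e -> edom h (p.2 + u)) _ cov)).
exists e => // x z u Ux xz zM; apply: (He (x, z)) => //.
by split=> //; rewrite /K /closed_ball_ /= sub0r normrN.
Qed.

(* With A convex this gives a compact convex set without any convex hull: the
   points whose e-neighbourhood stays in A, cut off at radius M. *)
Definition inner_body (A : set 'rV[R]_n) (M e : R) : set 'rV[R]_n :=
  [set v | `|v| <= M /\ forall u, `|u| < e -> A (v + u)].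

Lemma inner_body_sub (A : set 'rV[R]_n) (M e : R) : 0 < e ->
  inner_body A M e `<=` interior A.
Proof.
move=> e0 v [_ vA]; apply/nbhs_ballP; exists e => //= y.
rewrite -ball_normE /= distrC => /vA.
by rewrite addrC subrK.
Qed.

(** [A] itself may fail to be closed: if |u| < e and [y] in the body is within e - |u| of [v], then
    v + u is [y] shifted by v - y + u, still shorter than [e]. *)
Lemma inner_body_closed (A : set 'rV[R]_n) (M e : R) :
  closed (inner_body A M e).
Proof.
apply: closedI.
  have -> : (fun v : 'rV[R]_n => is_true (`|v| <= M)) = closed_ball_ Num.norm 0 M.
    by apply/funext => v; rewrite /closed_ball_ /= sub0r normrN.
  exact: closed_closed_ball_.
move=> v clv u ue.
have [y [yA]] := clv _ (nbhsx_ballx v (e - `|u|) ltac:(by rewrite subr_gt0)).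
rewrite -ball_normE /= => vy.
rewrite -(subrK y v) addrAC addrC; apply: yA.
by apply: le_lt_trans (ler_normD _ _) _; lra.
Qed.

Lemma inner_body_compact (A : set 'rV[R]_n) (M e : R) :
  compact (inner_body A M e).
Proof.
apply: bounded_closed_compact; last exact: inner_body_closed.
exists M; split; first exact: num_real.
by move=> y My v [vM _]; exact: le_trans vM (ltW My).
Qed.

Lemma inner_body_convex (A : set 'rV[R]_n) (M e : R) :
  convex_set A -> convex_set (inner_body A M e).
Proof.
move=> /convex_setP cA; apply/convex_setP => x y t [xM xA] [yM yA] t0 t1.
have t1' : 0 < 1 - t by rewrite subr_gt0.
split.
  apply: le_trans (ler_normD _ _) _; rewrite !normrZ !gtr0_norm//.
  nra.
move=> u ue.
have -> : t *: x + (1 - t) *: y + u = t *: (x + u) + (1 - t) *: (y + u).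
  by rewrite !scalerDr addrACA -scalerDl [t + _]addrC subrK scale1r.
by apply: cA => //; [exact: xA|exact: yA].
Qed.

Lemma edom_convex h : convex_efun h -> eproper h -> convex_set (edom h).
Proof.
move=> ch [h0 _]; apply/convex_setP => x y t hx hy t0 t1.
rewrite /edom /=; apply: le_lt_trans (ch x y t t0 t1) _.
move: hx hy; rewrite /edom /=; have := h0 x; have := h0 y.
case: (h x) (h y) => [a| |] [b| |] //= _ _ _ _.
by rewrite -!EFinM -EFinD ltry.
Qed.

(** [G] is [F] plus the indicator of [V], hence at least [F]; a minimiser of [F] exists and lies in
    [V], so both problems share their minimum value. *)
Lemma argmin_restrict (F G : 'rV[R]_n -> \bar R) (V : set 'rV[R]_n) :
  argmin F !=set0 -> argmin F `<=` V ->
  (forall w, V w -> G w = F w) -> (forall w, ~ V w -> G w = +oo%E) ->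
  argmin F = argmin G /\ ereal_inf (range F) = ereal_inf (range G).
Proof.
move=> [z zF] FV GF Goo.
have FG w : (F w <= G w)%E.
  by have [/GF->//|/Goo->] := pselect (V w); rewrite leey.
have Gz : G z = F z by apply/GF/FV.
have argminE (H : 'rV[R]_n -> \bar R) v : argmin H v -> ereal_inf (range H) = H v.
  move=> vH; apply/eqP; rewrite eq_le; apply/andP; split.
    by apply: ereal_inf_lbound; exists v.
  by apply/ereal_infP => _ [w _ <-]; exact: vH.
have zG : argmin G z by move=> w; rewrite Gz; exact: le_trans (zF w) (FG w).
split; last by rewrite (argminE _ _ zF) (argminE _ _ zG).
apply/seteqP; split=> v vF w.
  by rewrite GF; [exact: le_trans (vF w) (FG w)|exact: FV].
apply: le_trans (FG v) _; apply: le_trans (vF z) _.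
by rewrite Gz.
Qed.

End ProximalMap.

(** * The forward-backward model and the properties of [ftilde] and [gtilde] *)

Section ForwardBackwardSplitting.
Context {R : realType} {n : nat}.
Implicit Types (h phi : 'rV[R]_n -> \bar R) (x z w u v : 'rV[R]_n).

Lemma ftilde_grad h (gamma gammat : R) x : legendre_kernel h -> idom h x ->
  ediff (ftilde h gamma gammat) x /\
  egrad (ftilde h gamma gammat) x = gammat^-1 *: x - gamma^-1 *: egrad h x.
Proof.
move=> lh hx; have [[fh dh] _] := legendre_C1 lh hx.
(* Since [h] is finite near [x], [fine] commutes with the combination there. *)
have ftE : \forall y \near x,
    (- gamma^-1) *: (fine (h y) : R^o) + (2 * gammat)^-1 *: (enorm y ^+ 2 : R^o) =
    fine (ftilde h gamma gammat y).
  by apply: filterS fh => y hy; rewrite /ftilde -(fineK hy).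
have dq := differentiable_sqnorm x.
have dh' : differentiable (fun y => fine (h y) : R) x := dh.
have df := differentiableD (differentiableZ (- gamma^-1) dh')
  (differentiableZ (2 * gammat)^-1 dq).
split; first split.
- by apply: filterS fh => y hy; rewrite /ftilde -(fineK hy).
- by apply: near_eq_differentiable df; exact: ftE.
apply/rowP => i; rewrite !mxE -(near_eq_derive _ ftE).
have iq := is_derive_sqnorm x (delta_mx 0 i).
have ih : is_derive x (delta_mx 0 i) (fun y => fine (h y) : R)
    ('D_(delta_mx 0 i) (fine \o h) x).
  by apply: DeriveDef => //; exact: diff_derivable.
have idf := is_deriveD (is_deriveZ (- gamma^-1) ih)
  (is_deriveZ (2 * gammat)^-1 iq).
rewrite (@derive_val _ _ _ _ _ _ _ idf).
by rewrite dot_delta /GRing.scale /= invfM; lra.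
Qed.

(** With t = 1/gammat and g = 1/gamma, expanding the square gives at most (t^2 - 2tg/k + g^2 k^2) |x
    - y|^2. The bound gamma / k^3 on [gammat] gives g^2 k^2 <= tg/k; the bound gamma k makes the
    remaining t^2 - tg/k nonnegative. *)
Lemma lipschitz_perturbed_sqnorm (G : 'rV[R]_n -> 'rV[R]_n)
    (k gamma gammat : R) x y :
  0 < k -> 0 < gamma -> 0 < gammat ->
  gammat < gamma * k -> gammat < gamma / k ^+ 3 ->
  bilipschitz_monotone_at G k x y ->
  enorm ((gammat^-1 *: x - gamma^-1 *: G x) -
         (gammat^-1 *: y - gamma^-1 *: G y)) <=
  Num.sqrt (gammat^-1 ^+ 2 - gammat^-1 * gamma^-1 / k) * enorm (x - y).
Proof.
move=> k0 g0 gt0 small1 small2 [lip mono].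
set t := gammat^-1; set g := gamma^-1.
have t0 : 0 < t by rewrite invr_gt0.
have ig0 : 0 < g by rewrite invr_gt0.
have gk_t : g / k < t.
  by rewrite -invfM ltf_pV2 ?posrE ?mulr_gt0.
have gk3_t : g * k ^+ 3 < t.
  have -> : g * k ^+ 3 = (gamma / k ^+ 3)^-1 by rewrite invf_div mulrC.
  by rewrite ltf_pV2 ?posrE// divr_gt0 ?exprn_gt0.
have s0 : 0 <= t ^+ 2 - t * g / k.
  by rewrite expr2 -[X in _ - X]mulrA -mulrBr mulr_ge0 ?subr_ge0 ?ltW.
rewrite -(ler_pXn2r (ltn0Sn 1)) ?nnegrE ?mulr_ge0 ?enorm_ge0 ?sqrtr_ge0//.
rewrite exprMn (sqr_sqrtr s0).
have -> : t *: x - g *: G x - (t *: y - g *: G y) = t *: (x - y) - g *: (G x - G y).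
  by rewrite !scalerBr !opprD !opprK addrACA.
have -> : enorm (t *: (x - y) - g *: (G x - G y)) ^+ 2 =
    t ^+ 2 * enorm (x - y) ^+ 2 - 2 * t * g * dot (G x - G y) (x - y)
    + g ^+ 2 * enorm (G x - G y) ^+ 2.
  move: (G x - G y) (x - y) => D d.
  rewrite !enorm_sqr !dotE (dotC d D); ring.
have lip2 : g ^+ 2 * enorm (G x - G y) ^+ 2 <=
    g ^+ 2 * (k ^+ 2 * enorm (x - y) ^+ 2).
  rewrite ler_pM2l ?exprn_gt0// -exprMn ler_pXn2r ?nnegrE ?enorm_ge0//.
  by rewrite mulr_ge0 ?enorm_ge0// ltW.
have mono2 : 2 * t * g * (k^-1 * enorm (x - y) ^+ 2) <=
    2 * t * g * dot (G x - G y) (x - y).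
  by rewrite ler_pM2l ?mulr_gt0.
have gk2 : g ^+ 2 * k ^+ 2 <= t * g / k.
  have -> : g ^+ 2 * k ^+ 2 = g * k ^+ 3 * (g / k) by field; rewrite gt_eqF.
  by rewrite -[leRHS]mulrA ler_wpM2r ?ltW// divr_gt0.
have := ler_wpM2r (exprn_ge0 2 (enorm_ge0 (x - y))) gk2.
lra.
Qed.

Definition fb_model h phi (gamma gammat : R) (V : set 'rV[R]_n) x w : \bar R :=
  let ft := ftilde h gamma gammat in
  (ft x + (dot (egrad ft x) (w - x))%:E + gtilde h phi gamma gammat V w
   + ((2 * gammat)^-1 * enorm (w - x) ^+ 2)%:E)%E.

(** Properness keeps the other summands above -oo, which would otherwise absorb the +oo of the
    indicator. *)
Lemma gtilde_out h phi (gamma gammat : R) (V : set 'rV[R]_n) w : 0 < gamma ->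
  eproper h -> eproper phi -> ~ V w -> gtilde h phi gamma gammat V w = +oo%E.
Proof.
move=> g0 ph pp nV; rewrite /gtilde /indicator memNset//.
have ig0 : 0 < gamma^-1 by rewrite invr_gt0.
have := ph.1 w; have := pp.1 w.
by case: (phi w) (h w) => [p| |] [b| |] //= _ _; rewrite gt0_muley ?lte_fin.
Qed.

Lemma gtilde_in h phi (gamma gammat : R) (V : set 'rV[R]_n) w :
  V w -> gtilde h phi gamma gammat V w =
  (phi w + (gamma^-1)%:E * h w - ((2 * gammat)^-1 * enorm w ^+ 2)%:E)%E.
Proof. by move=> Vw; rewrite /gtilde /indicator mem_set// adde0. Qed.

Lemma fb_model_out h phi (gamma gammat : R) (V : set 'rV[R]_n) x w : 0 < gamma ->
  eproper h -> eproper phi -> idom h x -> ~ V w ->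
  fb_model h phi gamma gammat V x w = +oo%E.
Proof.
move=> g0 ph pp hx nV; rewrite /fb_model gtilde_out// /ftilde.
by have := idom_fin ph hx; case: (h x).
Qed.

Lemma fb_model_in h phi (gamma gammat : R) (V : set 'rV[R]_n) x w :
  0 < gamma -> 0 < gammat ->
  legendre_kernel h -> eproper phi -> idom h x -> idom h w -> V w ->
  fb_model h phi gamma gammat V x w =
  (phi w + (gamma^-1)%:E * bregman h w x)%E.
Proof.
move=> g0 gt0 lh pp hx hw Vw; have ph := legendre_proper lh.
rewrite /fb_model gtilde_in// bregman_objectiveE// (ftilde_grad _ _ lh hx).2 /tangent.
rewrite /ftilde -(fineK (idom_fin ph hx)) -(fineK (idom_fin ph hw)).
have := pp.1 w; case: (phi w) => [p| |] // _.
congr EFin => /=; rewrite !enorm_sqr !dotE (dotC w x) !invfM.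
by field; rewrite !gt_eqF.
Qed.

Lemma prox_objective_fb_model h phi (gamma gammat : R) (V : set 'rV[R]_n) x :
  0 < gammat -> eproper h -> idom h x ->
  exists k : R, forall w,
    let ft := ftilde h gamma gammat in
    (gtilde h phi gamma gammat V w
      + ((2 * gammat)^-1 * enorm (w - (x - gammat *: egrad ft x)) ^+ 2)%:E + k%:E)%E
    = fb_model h phi gamma gammat V x w.
Proof.
move=> gt0 ph hx.
have [f fE] : exists f : R, ftilde h gamma gammat x = f%:E.
  by rewrite /ftilde -(fineK (idom_fin ph hx)); eexists.
set g := egrad (ftilde h gamma gammat) x.
(* Completing the square: |w - x + gammat g|^2 / (2 gammat) exceeds the linear and quadratic terms
   of the model by gammat/2 |g|^2. *)
exists (f - gammat / 2 * enorm g ^+ 2) => w /=.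
rewrite /fb_model /= -/g fE; case: (gtilde _ _ _ _ _ _) => [q| |] //.
congr EFin => /=.
rewrite !enorm_sqr !dotE (dotC w x) (dotC w g) (dotC x g) !invfM.
by field; rewrite gt_eqF.
Qed.

Lemma argmin_addr (F : 'rV[R]_n -> \bar R) (k : R) :
  argmin (fun w => F w + k%:E)%E = argmin F.
Proof. by apply/seteqP; split=> z zF w; have := zF w; rewrite leeD2rE. Qed.

Lemma gtilde_proper h phi (gamma gammat : R) (V : set 'rV[R]_n) w :
  0 < gamma -> eproper h -> eproper phi -> V w -> edom phi w -> edom h w ->
  eproper (gtilde h phi gamma gammat V).
Proof.
move=> g0 ph pp Vw pw hw; have ig0 : 0 < gamma^-1 by rewrite invr_gt0.
split.
  move=> x; have [Vx|nVx] := pselect (V x); last by rewrite gtilde_out.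
  rewrite gtilde_in//; have := ph.1 x; have := pp.1 x.
  case: (phi x) (h x) => [p| |] [b| |] //= _ _; rewrite ?ltNyr// ?gt0_muley ?lte_fin//.
exists w; rewrite gtilde_in//; move: pw hw; rewrite /edom /=.
have := ph.1 w; have := pp.1 w.
by case: (phi w) (h w) => [p| |] [b| |] //= _ _ _ _; rewrite ltry.
Qed.

(** Off the closed set [V] the value is +oo on a neighbourhood. At a point of [V], neighbours in [V]
    follow the lsc sum minus a continuous term, and neighbours outside only have larger values. *)
Lemma gtilde_lower_semicontinuous h phi (gamma gammat : R) (V : set 'rV[R]_n) :
  0 < gamma -> eproper h -> eproper phi ->
  lower_semicontinuous h -> lower_semicontinuous phi -> closed V ->
  lower_semicontinuous (gtilde h phi gamma gammat V).
Proof.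
move=> g0 ph pp lh lp cV x a ax.
suff near_a : \forall y \near x, (a%:E < gtilde h phi gamma gammat V y)%E.
  by exists [set y | (a%:E < gtilde h phi gamma gammat V y)%E].
have [Vx|nVx] := pselect (V x); last first.
  have : \forall y \near x, ~ V y.
    by have oV := closed_openC cV; apply: open_nbhs_nbhs; split.
  by apply: filterS => y nVy; rewrite gtilde_out// ltry.
have lF := objective_lower_semicontinuous g0 ph pp lh lp.
have cc : {for x, continuous (fun y : 'rV[R]_n => (2 * gammat)^-1 * enorm y ^+ 2)}.
  have c0 := differentiable_continuous (differentiable_sqnorm x).
  exact: (cvgM (cvg_cst _) c0).
move: ax; rewrite gtilde_in// => /(lower_semicontinuous_sub lF cc).
apply: filterS => y ay; have [Vy|nVy] := pselect (V y).
  by rewrite gtilde_in.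
by rewrite gtilde_out// ltry.
Qed.

(** For every positive gamma the objective at base point 0 is lsc and +oo off [V], so its minimum
    over [V] bounds the envelope away from -oo. *)
Lemma prox_threshold_compact (g : 'rV[R]_n -> \bar R) (V : set 'rV[R]_n) :
  (forall x, -oo < g x)%E -> lower_semicontinuous g ->
  compact V -> V !=set0 -> (forall x, ~ V x -> g x = +oo%E) ->
  prox_threshold half_sqnorm g = +oo%E.
Proof.
move=> g0 lg cV V0 gV.
have i0 : idom (@half_sqnorm R n) 0.
  by rewrite /idom /interior; apply: filterS filterT => x _; exact: ltry.
suff all_gamma (gamma : R) : 0 < gamma -> (-oo < benv half_sqnorm g gamma 0%R)%E.
  apply/eqyP => A A0; apply: ereal_sup_ubound; exists A => //; split => //.
  by exists 0 => //; exact: all_gamma.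
move=> gamma0.
(* The vector [e] stays abstract: it contributes a linear, hence continuous, term to [c]. *)
pose e := egrad (@half_sqnorm R n) 0.
pose c w : R := gamma^-1 * (dot e w - 2^-1 * enorm w ^+ 2).
have objE w : (g w + (gamma^-1)%:E * bregman half_sqnorm w 0%R)%E =
    (g w - (c w)%:E)%E.
  rewrite /bregman mem_set// /half_sqnorm -/e -!EFinB -EFinM -EFinN; congr (_ + _%:E)%E.
  rewrite /c subr0 (_ : enorm (0 : 'rV[R]_n) ^+ 2 = 0); first by ring.
  by rewrite enorm_sqr -(scale0r (0 : 'rV[R]_n)) dotZl mul0r.
have cc x : {for x, continuous c}.
  have c0 := differentiable_continuous (differentiable_sqnorm x).
  have c1 : {for x, continuous (fun w => dot e w)}.
    apply: (continuous_dot (f := fun=> e) (g := id)) => //.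
    exact: cst_continuous.
  exact: (cvgM (cvg_cst _) (cvgB c1 (cvgM (cvg_cst _) c0))).
have [|z Vz zmin] := @lsc_compact_min R _ V (fun w => g w - (c w)%:E)%E cV V0.
  by move=> x a; exact: lower_semicontinuous_sub.
apply: (@lt_le_trans _ _ (g z - (c z)%:E)%E).
  by have := g0 z; case: (g z) => [r| |] //= _; rewrite ltNyr.
apply/ereal_infP => _ [w _ <-]; rewrite objE.
have [Vw|nVw] := pselect (V w); first exact: zmin.
by rewrite [X in (_ <= X)%E](_ : _ = +oo%E) ?leey// gV.
Qed.

End ForwardBackwardSplitting.

(** * Gradient constants on [V], construction of [V], and the theorem *)

Lemma egrad_bilipschitz_monotone (R : realType) (n : nat)
    (h : 'rV[R]_n -> \bar R) (V : set 'rV[R]_n) :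
  locally_lipschitz_differentiable h (idom h) ->
  locally_strongly_convex h (idom h) ->
  compact V -> convex_set V -> V `<=` idom h ->
  exists2 k, 0 < k &
    forall x y, V x -> V y -> bilipschitz_monotone_at (egrad h) k x y.
Proof.
move=> hl hs cV convV Vh; apply: bilipschitz_monotone_compact => // x /Vh hx.
have [N1 [nN1 _ _ [L [_ lipL]]]] := hl _ hx.
have [N2 [nN2 cN2 N2h [sigma s0 convs]]] := hs _ hx.
(* [N2] need not lie in [N1], so differentiability at each of its points comes from a Lipschitz
   neighbourhood of that point. *)
have dh y : N2 y -> differentiable (fine \o h : _ -> R) y.
  move=> /N2h hy; have [N [nN _ _ [L' [ed _]]]] := hl _ hy.
  exact: (ed _ (nbhs_singleton nN)).2.
have k0 : 0 < Num.max L sigma^-1 by rewrite lt_max invr_gt0 s0 orbT.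
exists (N1 `&` N2), (Num.max L sigma^-1); split => //; first exact: filterI.
move=> y z [y1 y2] [z1 z2]; split.
  apply: le_trans (lipL _ _ y1 z1) _.
  by rewrite ler_wpM2r ?enorm_ge0// le_max lexx.
apply: le_trans (strongly_convex_monotone cN2 convs dh y2 z2).
rewrite ler_wpM2r ?exprn_ge0 ?enorm_ge0//.
by rewrite -[leRHS]invrK lef_pV2 ?posrE ?invr_gt0// le_max lexx orbT.
Qed.

Lemma bprox_compact_convex_cover (R : realType) (n : nat)
    (h phi : 'rV[R]_n -> \bar R) (gamma : R) (U : set 'rV[R]_n) :
  legendre_kernel h -> eproper phi -> lower_semicontinuous phi ->
  0 < gamma -> (gamma%:E < prox_threshold h phi)%E ->
  bprox_range h phi gamma `<=` idom h -> compact U -> U `<=` idom h ->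
  exists V : set 'rV[R]_n, [/\ convex_set V, compact V, U `<=` V, V `<=` idom h &
    forall x, U x -> bprox h phi gamma x `<=` V].
Proof.
move=> lh pp lp g0 thr rg cU Uh.
have [w [pw hw]] := objective_dom_nonempty g0 lh pp rg.
have [M1 hM1] := bregman_objective_coercive g0 lh pp thr cU Uh pw hw.
have [M2 hM2] : exists M, forall x : 'rV[R]_n, U x -> `|x| <= M.
  apply: compact_upper_bound => // x _.
  exact: (@norm_continuous _ 'rV[R]_n).
have [e1 e10 he1] := compact_thickening cU Uh.
have [e2 e20 he2] := bprox_thickening M1 g0 lh pp lp rg cU Uh.
(* [M2] and [e1] accommodate [U]; [M1] and [e2] accommodate the proximal points. Convexity comes
   from dom h. *)
exists (inner_body (edom h) (Num.max M1 M2) (Num.min e1 e2)).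
have e0 : 0 < Num.min e1 e2 by rewrite lt_min e10.
split.
- apply: inner_body_convex; apply: edom_convex; first exact: legendre_convex.
  exact: legendre_proper.
- exact: inner_body_compact.
- move=> x Ux; split; first by rewrite le_max hM2// orbT.
  by move=> u; rewrite lt_min => /andP[ue _]; exact: he1.
- exact: inner_body_sub.
- move=> x Ux z xz; have zM : `|z| <= M1.
    rewrite leNgt; apply/negP => /(hM1 _ _ Ux).
    by rewrite ltNge xz.
  split; first by rewrite le_max zM.
  by move=> u; rewrite lt_min => /andP[_ ue]; exact: (he2 x).
Qed.

Theorem theorem3p8 (R : realType) (n : nat) (h phi : 'rV[R]_n -> \bar R)
    (gamma : R)
    (h_legendre : legendre_kernel h)
    (phi_proper : eproper phi)
    (phi_lsc : lower_semicontinuous phi)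
    (gamma_gt0 : 0 < gamma)
    (gamma_lt : (gamma%:E < prox_threshold h phi)%E)
    (h_lipdiff : locally_lipschitz_differentiable h (idom h))
    (h_strong : locally_strongly_convex h (idom h))
    (range_prox : bprox_range h phi gamma `<=` idom h)
    (U : set 'rV[R]_n) (U_compact : compact U) (U_sub : U `<=` idom h) :
  exists (gammabar : R) (V : set 'rV[R]_n),
    [/\ 0 < gammabar,
        convex_set V /\ compact V,
        U `<=` V,
        V `<=` idom h &
        forall gammat : R, 0 < gammat -> gammat < gammabar ->
          let ft := ftilde h gamma gammat in
          let gt := gtilde h phi gamma gammat V in
          [/\ forall x, U x ->
                benv h phi gamma x =
                  ereal_inf (range (fun w =>
                    ft x + (dot (egrad ft x) (w - x))%:E + gt w
                    + ((2 * gammat)^-1 * enorm (w - x) ^+ 2)%:E)%E)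
                /\ bprox h phi gamma x =
                     eprox gt gammat (x - gammat *: egrad ft x),
              eproper gt,
              lower_semicontinuous gt,
              prox_threshold half_sqnorm gt = +oo%E &
              exists L : R,
                [/\ 0 < L, lipschitz_differentiable_on ft V L
                  & gammat < 1 / L]]].
Proof.
have h_proper := legendre_proper h_legendre.
have [x0 hx0] := legendre_idom h_legendre.
(* The extra point x0 keeps gt proper when U is empty. *)
have cU' : compact (U `|` [set x0]) by apply: compactU => //; exact: compact_set1.
have [|V [convV cV U'V Vh proxV]] := bprox_compact_convex_cover h_legendre
  phi_proper phi_lsc gamma_gt0 gamma_lt range_prox cU'.
  by move=> x [/U_sub//|->].
have UV : U `<=` V by move=> x Ux; apply: U'V; left.
have [z0 z0prox] := bprox_nonempty gamma_gt0 h_legendre phi_proper phi_lsc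
  gamma_lt range_prox hx0.
have Vz0 : V z0 by apply: (proxV x0) => //; right.
have [w [phiw hw]] :=
  objective_dom_nonempty gamma_gt0 h_legendre phi_proper range_prox.
(* The minimal value is at most the finite one at [w]; thus [z0] witnesses that [gt] is proper. *)
have [phiz0 hz0] : edom phi z0 /\ edom h z0.
  apply: contrapT => nfin; have := z0prox w.
  rewrite [X in (X <= _)%E](bregman_objective_infty _ _ _ _ nfin)//.
  by rewrite [X in (_ <= X)%E]bregman_objective_fin.
have [k k0 kV] := egrad_bilipschitz_monotone h_lipdiff h_strong cV convV Vh.
exists (Num.min (gamma * k) (gamma / k ^+ 3)), V; split => //.
  by rewrite lt_min mulr_gt0// divr_gt0// exprn_gt0.
move=> gammat gt0; rewrite lt_min => /andP[small1 small2] ft gt; split.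
- move=> x Ux; have hx := U_sub _ Ux.
  have x_prox := bprox_nonempty gamma_gt0 h_legendre phi_proper phi_lsc
    gamma_lt range_prox hx.
  have [||argE infE] := @argmin_restrict _ _ _ (fb_model h phi gamma gammat V x)
    _ x_prox (proxV x (or_introl Ux)).
  + by move=> v Vv; apply: fb_model_in => //; exact: Vh.
  + by move=> v nVv; exact: fb_model_out.
  split; first exact: infE.
  rewrite [LHS]argE.
  have [c cE] := prox_objective_fb_model phi gamma V gt0 h_proper hx.
  rewrite -(funext cE); exact: argmin_addr.
- exact: (gtilde_proper gammat gamma_gt0 h_proper phi_proper Vz0 phiz0 hz0).
- apply: gtilde_lower_semicontinuous => //; first exact: legendre_lsc.
  by apply: compact_closed => //; exact: norm_hausdorff.
- apply: (@prox_threshold_compact _ _ gt V) => //.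
  + exact: (gtilde_proper gammat gamma_gt0 h_proper phi_proper Vz0 phiz0 hz0).1.
  + apply: gtilde_lower_semicontinuous => //; first exact: legendre_lsc.
    by apply: compact_closed => //; exact: norm_hausdorff.
  + by exists z0.
  + by move=> x; exact: gtilde_out.
- have t0 : 0 < gammat^-1 by rewrite invr_gt0.
  have kg_t : gamma^-1 / k < gammat^-1.
    by rewrite -invfM ltf_pV2 ?posrE ?mulr_gt0.
  (* The Lipschitz constant is sqrt s: s > 0 makes it positive, and s < gammat^-2 gives gammat <
     1/L. *)
  pose s := gammat^-1 ^+ 2 - gammat^-1 * gamma^-1 / k.
  have s0 : 0 < s.
    by rewrite /s expr2 -[X in _ - X]mulrA -mulrBr mulr_gt0 ?subr_gt0.
  have st : s < gammat^-1 ^+ 2.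
    by rewrite /s gtrBl divr_gt0 ?mulr_gt0 ?invr_gt0.
  exists (Num.sqrt s); split; first by rewrite sqrtr_gt0.
    split=> [x /Vh hx|x y Vx Vy]; first exact: (ftilde_grad _ _ h_legendre hx).1.
    rewrite !(ftilde_grad _ _ h_legendre (Vh _ _)).2//.
    by apply: lipschitz_perturbed_sqnorm => //; exact: kV.
  rewrite div1r -[ltLHS]invrK ltf_pV2 ?posrE ?sqrtr_gt0//.
  by rewrite -[ltRHS]gtr0_norm// -sqrtr_sqr ltr_sqrt ?exprn_gt0.
Qed.
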